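(* Let $G=(V,\mathcal{E})$ be a graph with countable vertex set $V$, and for each $n\ge 1$ let $V_n\subset V$ be a set of exactly $n$ vertices, let $\kappa^{(n)}\in\{-1,1\}^{V\setminus V_n}$ be a boundary condition and $h^{(n)}\in\mathbb{R}^{V_n}$ an external field. Let $J_{ij}=J_{ji}\in\mathbb{R}\setminus\{0\}$ for $\{i,j\}\in\mathcal{E}$ (and $J_{ij}:=0$ if $\{i,j\}\notin\mathcal{E}$). Assume \[K:=\sup_{n\ge1}\Big(\max_{i\in V_n}\sum_{j\in V}|J_{ij}|+\max_{i\in V_n}|h^{(n)}_i|\Big)<+\infty .\] Let $(\varepsilon_i)_{i\in V_n}$ (enumerated as $\varepsilon_1,\dots,\varepsilon_n$) be distributed according to the Gibbs measure $\mu_n$ defined in the context, and let \[Q_n=\sup_{x\in\mathbb{R}}\ \sup_{v_1,\dots,v_n\in\mathbb{R},\ |v_1|,\dots,|v_n|\ge 1} P\Big(\sum_{i=1}^n\varepsilon_iv_i\in(x-1,x+1)\Big).\] Then there is a constant $C(K)<\infty$ depending only on $K$ such that for all $n\ge1$, \[\binom{n}{\lfloor n/2\rfloor}2^{-n}\le Q_n\le C(K)\,n^{-1/2}.\]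
   Context: Let $\mathcal{E}_n=\{\{i,j\}\in\mathcal{E}: i\in V_n\text{ or }j\in V_n\}$. For $\sigma\in\{-1,1\}^{V_n}$, extend $\sigma$ to $V$ by $\sigma_j=\kappa^{(n)}_j$ for $j\notin V_n$, and define the Hamiltonian \[H_n(\sigma)=-\sum_{\{i,j\}\in\mathcal{E}_n}J_{ij}1_{\sigma_i=\sigma_j}-\sum_{i\in V_n}h^{(n)}_i\sigma_i\] (the edge sum converges absolutely under the assumption). The Gibbs measure is $\mu_n(\sigma)=e^{-H_n(\sigma)}/Z_n$ on $\{-1,1\}^{V_n}$, with $Z_n$ the normalizing constant. *)

(* Defs.v *)
From HB Require Import structures.
From mathcomp Require Import all_boot all_order all_algebra.
From mathcomp Require Import all_classical all_reals all_analysis.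
Set Implicit Arguments. Unset Strict Implicit. Unset Printing Implicit Defensive.
Import Order.TTheory GRing.Theory Num.Theory.
Local Open Scope ring_scope.
Local Open Scope classical_set_scope.

Section Ising.
Variables (R : realType) (V : countType).

(* Sum of an absolutely summable real family over a countable index type:
   (sum of positive parts) - (sum of negative parts). *)
Definition psum (T : choiceType) (f : T -> R) : R :=
  fine (\esum_(j in [set: T]) (Num.max (f j) 0)%:E)
  - fine (\esum_(j in [set: T]) (Num.max (- f j) 0)%:E).

Definition spin (b : bool) : R := if b then 1 else -1.

(* V_n is given by an injective enumeration vn : 'I_n -> V.
   sigma : {ffun 'I_n -> bool} is a configuration on V_n; it is extended
   to V by the boundary condition kappa off V_n. *)
Definition inVn (n : nat) (vn : 'I_n -> V) (j : V) : bool :=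
  [exists k, vn k == j].

Definition extend (n : nat) (vn : 'I_n -> V) (kappa : V -> bool)
  (sigma : {ffun 'I_n -> bool}) (j : V) : bool :=
  if [pick k | vn k == j] is Some k then sigma k else kappa j.

(* H_n(sigma) = - sum_{ {i,j} in E_n } J_ij 1_{sigma_i = sigma_j}
               - sum_{i in V_n} h_i sigma_i.
   The sum over unordered edges is written as half the sum over ordered
   pairs (i,j) in V x V with i in V_n or j in V_n (J vanishes off edges,
   and the graph has no loops). *)
Definition hamiltonian (n : nat) (vn : 'I_n -> V) (J : V -> V -> R)
  (kappa : V -> bool) (h : V -> R) (sigma : {ffun 'I_n -> bool}) : R :=
  - (psum (fun p : V * V =>
        if inVn vn p.1 || inVn vn p.2 then
          J p.1 p.2 * (if extend vn kappa sigma p.1 == extend vn kappa sigma p.2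
                       then 1 else 0)
        else 0) / 2)
  - \sum_(k < n) h (vn k) * spin (sigma k).

Definition partition_fn (n : nat) (vn : 'I_n -> V) (J : V -> V -> R)
  (kappa : V -> bool) (h : V -> R) : R :=
  \sum_(s : {ffun 'I_n -> bool}) expR (- hamiltonian vn J kappa h s).

Definition gibbs (n : nat) (vn : 'I_n -> V) (J : V -> V -> R)
  (kappa : V -> bool) (h : V -> R) (sigma : {ffun 'I_n -> bool}) : R :=
  expR (- hamiltonian vn J kappa h sigma) / partition_fn vn J kappa h.

Definition prob_window (n : nat) (vn : 'I_n -> V) (J : V -> V -> R)
  (kappa : V -> bool) (h : V -> R) (x : R) (v : 'I_n -> R) : R :=
  \sum_(s : {ffun 'I_n -> bool})
     (if (x - 1 < \sum_(k < n) spin (s k) * v k) &&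
         (\sum_(k < n) spin (s k) * v k < x + 1)
      then gibbs vn J kappa h s else 0).

Definition Qn (n : nat) (vn : 'I_n -> V) (J : V -> V -> R)
  (kappa : V -> bool) (h : V -> R) : R :=
  sup [set p | exists (x : R) (v : 'I_n -> R),
         (forall k, 1 <= `|v k|) /\ p = prob_window vn J kappa h x v].

Definition Kconst (vn : forall n : nat, 'I_n -> V) (J : V -> V -> R)
  (h : nat -> V -> R) : \bar R :=
  ereal_sup [set (\big[maxe/0%E]_(k < n) \esum_(j in [set: V]) (`|J (vn n k) j|)%:E
                  + (\big[Num.max/0]_(k < n) `|h n (vn n k)|)%:E)%E
            | n in [set n : nat | (0 < n)%N]].

End Ising.

(* Main.v *)
(** Upper bound: up to an additive constant, -H_n is a sum over ordered pairs of
    sites of local functions phi_e >= 0 whose sum around each site is O(K).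
    Expanding the product of the factors 1 + (exp phi_e - 1) over sets w of pairs,
    in the spirit of the random-cluster representation, writes the Gibbs weight as
    a sum of nonnegative weights, the w-th of which does not depend on the spins
    at the sites isolated in w.  These spins are therefore free signs, to which
    the Littlewood-Offord bound of Erdos (via Sperner) applies.  Given the spins, w
    contains each e independently with probability 1 - exp (- phi_e), so by
    Chebyshev's inequality a positive fraction of the sites is isolated outside an
    event of probability O(1/n).

    Lower bound: average the window probability over all sign vectors v. *)

Require Import Defs.
From HB Require Import structures.
From mathcomp Require Import all_boot all_order all_algebra zify ring lra.
From mathcomp Require Import all_classical all_reals all_analysis.
Set Implicit Arguments. Unset Strict Implicit. Unset Printing Implicit Defensive.
Import Order.TTheory GRing.Theory Num.Theory.
Local Open Scope ring_scope.

(** * Antichains and binomial coefficients *)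

(** Induction on the size of [X]. If [X] itself is in [A], the antichain condition leaves only the
    term [a = X]. Otherwise the sum for [X] is the average over [i] in [X] of the sums for [X :\ i],
    each at most 1. Localising to subsets of [X] is what lets the induction run. *)
Lemma lubell_yamamoto_meshalkin (R : realFieldType) (T : finType)
    (A : {set {set T}}) (X : {set T}) :
  {in A &, forall a b : {set T}, a \subset b -> a = b} ->
  \sum_(a in A | a \subset X) ('C(#|X|, #|a|)%:R : R)^-1 <= 1.
Proof.
move=> anti; have [m] := ubnP #|X|; elim: m X => // m IH X ltXm.
have [XA|XnA] := boolP (X \in A).
  rewrite (big_pred1 X) ?binn ?invr1// => a /=.
  apply/andP/eqP => [[aA aX]|->]; [exact: anti|by split].
have [X0|/set0Pn[x0 x0X]] := eqVneq X finset.set0.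
  rewrite big_pred0 ?ler01// => a; rewrite X0 finset.subset0.
  by apply/andP => -[aA /eqP a0]; move: XnA; rewrite X0 -a0 aA.
have X_gt0 : (0 < #|X|)%N by apply/card_gt0P; exists x0.
have XR_gt0 : 0 < #|X|%:R :> R by rewrite ltr0n.
(* Each [a] properly inside [X] survives in [X :\ i] for [#|X| - #|a|] choices of [i], and [(#|X| -
   #|a|) 'C(#|X|, #|a|) = #|X| 'C(#|X| - 1, #|a|)], so the average is exact. *)
have -> : \sum_(a in A | a \subset X) ('C(#|X|, #|a|)%:R : R)^-1 =
    #|X|%:R^-1 * \sum_(i in X) \sum_(a in A | a \subset X :\ i)
      ('C(#|X :\ i|, #|a|)%:R : R)^-1.
  rewrite (exchange_big_dep (fun a => (a \in A) && (a \subset X)))/=; last first.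
    by move=> i a _ /andP[-> aX]; rewrite (fintype.subset_trans aX)// finset.subD1set.
  rewrite mulr_sumr; apply: eq_bigr => a /andP[aA aX].
  have lt_aX : (#|a| < #|X|)%N.
    rewrite ltn_neqAle subset_leq_card// andbT; apply: contra XnA => /eqP e.
    by have /eqP <- : a == X by rewrite eqEcard aX e leqnn.
  rewrite (eq_bigr (fun=> ('C(#|X|.-1, #|a|)%:R : R)^-1)); last first.
    by move=> i /andP[iX _]; rewrite (cardsD1 i X) iX.
  rewrite (eq_bigl (mem (X :\: a))); last first.
    move=> i /=; rewrite !inE; have [iX|] := boolP (i \in X); last by rewrite andbF.
    rewrite aA /= andbT; apply/idP/idP => [/fintype.subsetP s|ia].
      by apply/negP => /s; rewrite !inE eqxx.
    by apply/fintype.subsetP => j ja; rewrite !inE (fintype.subsetP aX)// andbT; apply: contraNneq ia => <-.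
  rewrite sumr_const cardsD (finset.setIidPr aX).
  have := mul_bin_down #|X| #|a| => /(congr1 (fun k : nat => k%:R : R)).
  rewrite !natrM => e.
  have b1 : 'C(#|X|.-1, #|a|)%:R != 0 :> R by rewrite pnatr_eq0 -lt0n bin_gt0; lia.
  have b2 : 'C(#|X|, #|a|)%:R != 0 :> R by rewrite pnatr_eq0 -lt0n bin_gt0; lia.
  rewrite -[_ *+ (_ - _)]mulr_natr.
  have -> : (#|X| - #|a|)%:R = #|X|%:R * 'C(#|X|.-1, #|a|)%:R / 'C(#|X|, #|a|)%:R :> R.
    by rewrite e mulfK.
  by field; rewrite b1 b2 lt0r_neq0.
rewrite ler_pdivrMl// mulr1 -[leRHS]mul1r mulr_natr -sumr_const.
apply: ler_sum => i iX; apply: IH.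
by move: ltXm; rewrite (cardsD1 i X) iX.
Qed.

Lemma bin_le_half (n k : nat) : ('C(n, k) <= 'C(n, n./2))%N.
Proof.
have inc j d : (j + d = n./2)%N -> ('C(n, j) <= 'C(n, n./2))%N.
  elim: d j => [|d IH] j e; first by rewrite -e addn0.
  apply: leq_trans (IH j.+1 _); last lia.
  have := mul_bin_left n j; have : (j.+1 <= n - j)%N by lia.
  by nia.
have [kn|nk] := leqP k n; last by rewrite bin_small.
have [kh|hk] := leqP k n./2; first by apply: (inc k (n./2 - k)%N); lia.
rewrite -bin_sub//; apply: (inc _ (n./2 - (n - k))%N); lia.
Qed.

(** Squaring keeps the estimate in the natural numbers. By [rec] the inductive step amounts to
    [(2m + 1)(2m + 3) <= 4 (m + 1)^2]; the factor [2m + 1] on the left is chosen so that it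
    closes. *)
Lemma central_bin_sqr_le (m : nat) : ('C(m.*2, m) ^ 2 * m.*2.+1 <= 4 ^ m.*2)%N.
Proof.
elim: m => [|m IH]; first by rewrite bin0.
have rec : (m.+1 * 'C(m.+1.*2, m.+1) = 2 * m.*2.+1 * 'C(m.*2, m))%N.
  have := mul_bin_diag m.*2.+2 m; have := mul_bin_down m.*2.+1 m.
  rewrite /= doubleS; have -> : (m.*2.+1 - m = m.+1)%N by lia.
  by move: ('C(_, _)) ('C(_, _)) ('C(_, _)) => a b c; nia.
have -> : (4 ^ m.+1.*2 = 16 * 4 ^ m.*2)%N by rewrite doubleS !expnS mulnA.
move: IH rec; rewrite doubleS.
move: 'C(_, _) 'C(_, _) (4 ^ _)%N => b a c IH rec.
rewrite -(@leq_pmul2l (m.+1 ^ 2))// mulnA -expnMn rec.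
have -> : ((2 * m.*2.+1 * a) ^ 2 * m.*2.+3 = (4 * m.*2.+1 * m.*2.+3) * (a ^ 2 * m.*2.+1))%N by nia.
rewrite (mulnA _ 16%N) (mulnC _ 16%N).
by apply: leq_mul => //; nia.
Qed.

Lemma bin_sqr_le (n k : nat) : ('C(n, k) ^ 2 * n <= 4 ^ n)%N.
Proof.
apply: (@leq_trans ('C(n, n./2) ^ 2 * n.+1)%N).
  by rewrite leq_mul// leq_exp2r// bin_le_half.
move: (odd_double_half n) => /esym; move: n./2 => m.
case: (odd n) => ->; last by rewrite add0n central_bin_sqr_le.
(* For odd [n = 2m + 1] the even case [2m + 2] suffices, because its central coefficient is exactly
   [2 'C(2m + 1, m)]. *)
rewrite add1n; have := central_bin_sqr_le m.+1.
have -> : 'C(m.+1.*2, m.+1) = (2 * 'C(m.*2.+1, m))%N.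
  rewrite doubleS binS -(@bin_sub m.*2.+1 m.+1); last lia.
  by rewrite subSS -addnn addnK addnn addnn mul2n.
rewrite doubleS !expnS expn0 muln1; move: 'C(_,_) (4 ^ _)%N => a b; nia.
Qed.

(** Sperner's theorem in quantitative form: each term of the LYM sum is at least [sqrt m / 2 ^ m]
    with [m = #|W|]. The product form also covers [m = 0]. *)
Lemma antichain_card_le (R : realType) (T : finType) (A : {set {set T}})
    (W : {set T}) :
  {in A &, forall a b : {set T}, a \subset b -> a = b} ->
  {in A, forall a : {set T}, a \subset W} ->
  #|A|%:R * Num.sqrt #|W|%:R <= 2 ^+ #|W| :> R.
Proof.
move=> anti AW; set m := #|W|; have [m0|m_gt0] := posnP m.
  by rewrite m0 sqrtr0 mulr0 expr0 ler01.
have s_gt0 : 0 < Num.sqrt m%:R :> R by rewrite sqrtr_gt0 ltr0n.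
have b_gt0 (a : {set T}) : a \in A -> 0 < 'C(m, #|a|)%:R :> R.
  by move=> /AW/subset_leq_card am; rewrite ltr0n bin_gt0.
have bin_le k : 'C(m, k)%:R * Num.sqrt m%:R <= 2 ^+ m :> R.
  rewrite -(@ler_pXn2r _ 2) ?nnegrE ?mulr_ge0 ?exprn_ge0 ?sqrtr_ge0//.
  rewrite exprMn sqr_sqrtr// -exprM mulnC exprM -!natrX -natrM ler_nat.
  exact: bin_sqr_le.
have := lubell_yamamoto_meshalkin R W anti.
rewrite (eq_bigl (mem A)); last first.
  by move=> a /=; case: (boolP (a \in A)) => // /AW ->.
move=> lym; rewrite -ler_pdivlMr// -[leRHS]mulr1.
apply: le_trans (ler_wpM2l _ lym); last by rewrite divr_ge0 ?exprn_ge0 ?sqrtr_ge0.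
rewrite mulr_sumr -[leLHS]mul1r mulr_natr -sumr_const.
by apply: ler_sum => a aA; rewrite ler_pdivlMr ?b_gt0// mul1r ler_pdivlMr.
Qed.

(** * The Littlewood-Offord bound for weights with free coordinates *)

(* Resampling the coordinates in W uniformly leaves the total weight of F
   unchanged, and once the other coordinates are fixed the configurations of W
   landing in the window form an antichain. *)
Lemma littlewood_offord_free_coordinates (R : realType) (I : finType) (W : {set I})
    (F : {ffun I -> bool} -> R) (v : I -> R) (x : R) :
  (forall s, 0 <= F s) ->
  (forall s t : {ffun I -> bool}, (forall i, i \notin W -> s i = t i) -> F s = F t) ->
  (forall i, 1 <= `|v i|) ->
  (\sum_(s : {ffun I -> bool}) (if (x - 1 < \sum_i spin R (s i) * v i) &&
              (\sum_i spin R (s i) * v i < x + 1) then F s else 0))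
    * Num.sqrt #|W|%:R <= \sum_s F s.
Proof.
move=> F_ge0 FW v1.
pose S (s : {ffun I -> bool}) := \sum_i spin R (s i) * v i.
pose win s := (x - 1 < S s) && (S s < x + 1).
(* The twist by [v i < 0] makes membership of [i] in [a] mean that coordinate [i] contributes
   [+|v i|], so the signed sum increases with [a] whatever the signs of [v]. *)
pose put (s : {ffun I -> bool}) (a : {set I}) : {ffun I -> bool} :=
  [ffun i => if i \in W then (i \in a) (+) (v i < 0) else s i].
pose get (s : {ffun I -> bool}) : {set I} := [set i in W | s i (+) (v i < 0)]%SET.
have put_get s (a : {set I}) : a \subset W -> put (put s a) (get s) = s /\ get (put s a) = a.
  move=> aW; split.
    apply/ffunP => i; rewrite !ffunE !inE; case: (i \in W) => //=.
    by rewrite -addbA addbb addbF.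
  apply/setP => i; rewrite !inE ffunE; have [iW|iW] /= := boolP (i \in W).
    by rewrite -addbA addbb addbF.
  by apply/esym/negP => /(fintype.subsetP aW); rewrite (negPf iW).
have resample (G : {ffun I -> bool} -> R) :
    \sum_s \sum_(a in powerset W) G (put s a) = 2 ^+ #|W| * \sum_s G s.
  rewrite pair_big_dep /=.
  (* Swapping the content of [W] between [s] and [a] is an involution on the pairs with [a] inside
     [W]. *)
  rewrite (reindex_onto (fun p : {ffun I -> bool} * {set I} => (put p.1 p.2, get p.1))
     (fun p => (put p.1 p.2, get p.1)))/=; last first.
    by move=> [s a]; rewrite /= powersetE => /(put_get s)[-> ->].
  rewrite (eq_big (fun p => p.2 \in powerset W) (fun p => G p.1)).
  - rewrite -(pair_big_dep predT (fun _ a => a \in powerset W) (fun s _ => G s)) /=.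
    rewrite mulr_sumr; apply: eq_bigr => s _.
    by rewrite sumr_const card_powerset -[LHS]mulr_natl natrX.
  - move=> [s a]; rewrite !powersetE /=; apply/idP/idP => [/andP[_ /eqP[_ <-]]|aW].
      by apply/fintype.subsetP => i; rewrite inE => /andP[].
    have [-> ->] := put_get s a aW; rewrite eqxx andbT.
    by apply/fintype.subsetP => i; rewrite inE => /andP[].
  - by move=> [s a] /= /andP[_ /eqP[-> _]].
have F_put s a : F (put s a) = F s.
  by apply: FW => i iW; rewrite ffunE (negPf iW).
have p2 : 0 < 2 ^+ #|W| :> R by rewrite exprn_gt0.
rewrite -(ler_pM2l p2) -/S mulrA -resample mulr_suml mulr_sumr; apply: ler_sum => s _.
rewrite (eq_bigr (fun a => if win (put s a) then F s else 0)); last first.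
  by move=> a _; rewrite F_put.
rewrite -big_mkcondr /= -[X in _ <= X]mulrC.
pose A := [set a in powerset W | win (put s a)]%SET.
rewrite (eq_bigl (mem A)); last by move=> a; rewrite !inE.
rewrite sumr_const -[_ *+ #|_|]mulr_natr -mulrA ler_wpM2l// antichain_card_le//; last first.
  by move=> a; rewrite !inE => /andP[].
move=> a b; rewrite !inE => /andP[aW wa] /andP[bW wb] ab.
apply/eqP; rewrite finset.eqEsubset ab /=; apply/negPn/negP => /fintype.subsetPn[j jb ja].
have jW := fintype.subsetP bW _ jb.
have term c i : spin R (put s c i) * v i =
    if i \in W then (if i \in c then `|v i| else - `|v i|) else spin R (s i) * v i.
  rewrite ffunE /spin; case: (i \in W) => //.
  have [vi|vi] := ltrP (v i) 0; first by rewrite ltr0_norm//; case: (i \in c) => /=; lra.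
  by rewrite ger0_norm//; case: (i \in c) => /=; lra.
(* An element [j] of [b] outside [a] changes its contribution from [-|v j|] to [+|v j|], a gain of
   at least 2, the length of the window; as the window is open it cannot hold both sums. *)
have : S (put s a) + 2 <= S (put s b).
  rewrite /S (bigD1 j)//= [leRHS](bigD1 j)//= addrAC lerD//.
    by rewrite !term jW jb (negPf ja); have := v1 j; lra.
  apply: ler_sum => i _; rewrite !term; case: (i \in W) => //.
  have [/(fintype.subsetP ab) -> //|_] := boolP (i \in a).
  by have := v1 i; case: (i \in b) => //; lra.
by move: wa wb; rewrite /win => /andP[] ? ? /andP[]; lra.
Qed.

(** * Random sets of pairs and their isolated vertices *)

(** The law of a random set with independent memberships; [q e] is the probability that [e] is
    absent. *)
Definition product_bernoulli (R : realType) (E : finType) (q : E -> R)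
  (w : {set E}) : R := \prod_e (if e \in w then 1 - q e else q e).

Lemma product_bernoulli_ge0 (R : realType) (E : finType) (q : E -> R) w :
  (forall e, 0 <= q e <= 1) -> 0 <= product_bernoulli q w.
Proof.
move=> q01; apply: prodr_ge0 => e _; have /andP[q0 q1] := q01 e.
by case: ifP => _ //; rewrite subr_ge0.
Qed.

(** The probability that the random set misses [B], obtained by expanding a product of binomials
    over all subsets. *)
Lemma product_bernoulli_disjoint (R : realType) (E : finType) (q : E -> R)
    (B : {set E}) :
  \sum_w product_bernoulli q w * [disjoint w & B]%:R = \prod_(e in B) q e.
Proof.
transitivity (\prod_e ((if e \in B then 0 else 1 - q e) + q e)); last first.
  rewrite [RHS]big_mkcond; apply: eq_bigr => e _.
  by case: ifP => _; rewrite ?add0r ?subrK.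
rewrite bigA_distr; apply: eq_bigr => w _.
have [dis|] := boolP [disjoint w & B].
  rewrite mulr1; apply: eq_bigr => e _.
  by case: ifP => // ew; rewrite (disjointFr dis ew).
rewrite -setI_eq0 => /set0Pn[e]; rewrite inE => /andP[ew eB].
by rewrite mulr0 (bigD1 e)//= ew eB mul0r.
Qed.

Lemma product_bernoulli_sum1 (R : realType) (E : finType) (q : E -> R) :
  \sum_w product_bernoulli q w = 1.
Proof.
rewrite -(big_set0 1 *%R q) -[RHS]product_bernoulli_disjoint.
by apply: eq_bigr => w _; rewrite -setI_eq0 finset.setI0 eqxx mulr1.
Qed.

Lemma chebyshev_lower_tail (R : realType) (O : finType) (nu N : O -> R) (V t : R) :
  (forall w, 0 <= nu w) -> \sum_w nu w = 1 ->
  let m := \sum_w nu w * N w in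
  \sum_w nu w * N w ^+ 2 <= m ^+ 2 + V -> t <= m ->
  (\sum_(w | N w < t) nu w) * (m - t) ^+ 2 <= V.
Proof.
move=> nu_ge0 nu1 m second tm.
apply: (@le_trans _ _ (\sum_w nu w * (N w - m) ^+ 2)).
  rewrite mulr_suml big_mkcond; apply: ler_sum => w _.
  case: ifP => [Nt|_]; last by rewrite mulr_ge0// sqr_ge0.
  by rewrite ler_wpM2l// -[leRHS]sqrrN opprB ler_sqr ?nnegrE; lra.
rewrite (eq_bigr (fun w => nu w * N w ^+ 2 + (- 2 * m) * (nu w * N w) + m ^+ 2 * nu w)).
  rewrite !big_split/= -!mulr_sumr nu1 -/m; lra.
by move=> w _; ring.
Qed.

(** Pairs are ordered, and the diagonal pair [(i, i)] is included: it will carry the fields acting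
    at [i]. *)
Definition star (I : finType) (i : I) : {set I * I} :=
  [set e | (e.1 == i) || (e.2 == i)].

Definition isolated (I : finType) (w : {set I * I}) : {set I} :=
  [set i | [disjoint w & star i]].

(** Each vertex is isolated with probability at least [exp (- L)], which bounds the mean number of
    isolated vertices below. Two isolation events are correlated only through pairs common to both
    stars, so the variance is at most [2 L #|I|]. Chebyshev's inequality is applied at half the
    lower bound on the mean. *)
Lemma isolated_lower_tail (R : realType) (I : finType) (y : I * I -> R) (L : R) :
  (forall e, 0 <= y e) -> (forall i, \sum_(e in star i) y e <= L) ->
  (\sum_(w | #|isolated w|%:R < #|I|%:R * expR (- L) / 2)
      product_bernoulli (fun e => expR (- y e)) w)
    * (#|I|%:R * expR (- L) / 2) ^+ 2 <= 2 * L * #|I|%:R.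
Proof.
move=> y0 yL; set nu := product_bernoulli _; set c := expR (- L).
have c_gt0 : 0 < c by exact: expR_gt0.
pose A (B : {set I * I}) := \sum_(e in B) y e.
have A_ge0 B : 0 <= A B by apply: sumr_ge0.
have closed (B : {set I * I}) : \sum_w nu w * [disjoint w & B]%:R = expR (- A B).
  by rewrite product_bernoulli_disjoint /A -sumrN expR_sum.
have nu_ge0 w : 0 <= nu w.
  by apply: product_bernoulli_ge0 => e; rewrite expR_ge0 expR_le1 oppr_le0 y0.
have NE w : #|isolated w|%:R = \sum_i [disjoint w & star i]%:R :> R.
  rewrite -natr_sum -sum1_card; congr _%:R.
  by rewrite big_mkcond; apply: eq_bigr => i _; rewrite inE; case: ifP.
pose N (w : {set I * I}) : R := #|isolated w|%:R.
have mean : \sum_w nu w * N w = \sum_i expR (- A (star i)).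
  under eq_bigr do rewrite /N NE mulr_sumr.
  by rewrite exchange_big; apply: eq_bigr => i _; rewrite closed.
have second : \sum_w nu w * N w ^+ 2 =
    \sum_i \sum_k expR (- A (star i :|: star k)).
  under eq_bigr do rewrite /N NE expr2 mulr_suml mulr_sumr.
  rewrite exchange_big; apply: eq_bigr => i _.
  under eq_bigr do rewrite mulr_sumr mulr_sumr.
  rewrite exchange_big; apply: eq_bigr => k _; rewrite -closed.
  apply: eq_bigr => w _; rewrite -natrM mulnb; congr (_ * (nat_of_bool _)%:R).
  by rewrite -!setI_eq0 finset.setIUr finset.setU_eq0.
(* With [u] the exponential for the union and [d] the weight of the intersection, the covariance is
   [u (1 - exp (- d)) <= d], since [u <= 1]. *)
have pair i k : expR (- A (star i :|: star k)) <=
    expR (- A (star i)) * expR (- A (star k)) + A (star i :&: star k).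
  have AUI : A (star i) + A (star k) = A (star i :|: star k) + A (star i :&: star k).
    rewrite /A !(big_mkcond (fun e => e \in _)) -!big_split /=.
    apply: eq_bigr => e _; rewrite finset.in_setU finset.in_setI.
    by case: (e \in star i); case: (e \in star k) => /=; rewrite ?addr0 ?add0r.
  rewrite -expRD -opprD AUI opprD expRD.
  have u1 : expR (- A (star i :|: star k)) <= 1 by rewrite expR_le1 oppr_le0.
  have u0 := expR_gt0 (- A (star i :|: star k)).
  have := expR_ge1Dx (- A (star i :&: star k)); have := A_ge0 (star i :&: star k).
  nra.
(* A pair [e] lies in [star k] only for [k = e.1] or [k = e.2], so it is counted at most twice. *)
have inter i : \sum_k A (star i :&: star k) <= 2 * L.
  apply: (@le_trans _ _ (2 * A (star i))); last by rewrite ler_pM2l //; exact: yL.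
  rewrite /A; under eq_bigr do under eq_bigl do rewrite finset.in_setI.
  under eq_bigr do rewrite big_mkcondr.
  rewrite exchange_big /= mulr_sumr; apply: ler_sum => e _.
  rewrite -big_mkcond (eq_bigl (mem [set e.1; e.2]%SET)); last first.
    by move=> k; rewrite /= !inE !(eq_sym k).
  by rewrite sumr_const -[leLHS]mulr_natl ler_wpM2r// ler_nat cards2; case: (_ != _).
have meanL : #|I|%:R * c <= \sum_w nu w * N w.
  rewrite mean mulr_natl -sumr_const; apply: ler_sum => i _.
  by rewrite ler_expR lerN2 yL.
have n_ge0 : 0 <= #|I|%:R * c by rewrite mulr_ge0// ltW.
apply: le_trans (@chebyshev_lower_tail R _ nu N (2 * L * #|I|%:R)
  (#|I|%:R * c / 2) nu_ge0 (product_bernoulli_sum1 _) _ _).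
- rewrite ler_wpM2l ?sumr_ge0// ler_sqr ?nnegrE; lra.
- rewrite second mean expr2 mulr_suml [X in _ + X]mulr_natr -sumr_const.
  rewrite -big_split; apply: ler_sum => i _ /=.
  apply: le_trans (lerD (lexx _) (inter i)); rewrite mulr_sumr -big_split /=.
  by apply: ler_sum => k _; exact: pair.
- by lra.
Qed.

(** * Concentration for exponential weights of pair interactions *)

(** The first term pays for the sets with few isolated vertices; the second is the Littlewood-Offord
    bound with [n exp (- L) / 2] free signs. *)
Definition concentration_constant (R : realType) (L : R) : R :=
  8 * `|L| / expR (- L) ^+ 2 + Num.sqrt (2 / expR (- L)).

(* Expanding exp (sum phi) = prod (1 + (exp phi - 1)) over sets w of edges gives a
   sum of nonnegative weights, each independent of the spins at the vertices
   isolated in w; for a fixed configuration, w is a product Bernoulli set. *)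
Lemma weighted_window_le (R : realType) (I : finType)
    (phi : I * I -> {ffun I -> bool} -> R) (B : I * I -> R) (L : R)
    (v : I -> R) (x : R) :
  (0 < #|I|)%N ->
  (forall e s, 0 <= phi e s <= B e) ->
  (forall e (s t : {ffun I -> bool}),
     s e.1 = t e.1 -> s e.2 = t e.2 -> phi e s = phi e t) ->
  (forall i, \sum_(e in star i) B e <= L) ->
  (forall i, 1 <= `|v i|) ->
  \sum_(s : {ffun I -> bool}) (if (x - 1 < \sum_i spin R (s i) * v i) &&
              (\sum_i spin R (s i) * v i < x + 1)
           then expR (\sum_e phi e s) else 0)
  <= concentration_constant L / Num.sqrt #|I|%:R *
     \sum_(s : {ffun I -> bool}) expR (\sum_e phi e s).
Proof.
move=> I_gt0 phiB phi_loc BL v1.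
pose win (s : {ffun I -> bool}) := (x - 1 < \sum_i spin R (s i) * v i) &&
  (\sum_i spin R (s i) * v i < x + 1).
pose wt s := expR (\sum_e phi e s).
pose nu s := product_bernoulli (fun e => expR (- phi e s)).
pose F w s := wt s * nu s w.
have phi0 e s : 0 <= phi e s by have /andP[] := phiB e s.
have nu_ge0 s w : 0 <= nu s w.
  by apply: product_bernoulli_ge0 => e; rewrite expR_ge0 expR_le1 oppr_le0 phi0.
have F_ge0 w s : 0 <= F w s by rewrite mulr_ge0// expR_ge0.
(* A pair in [w] contributes [exp phi (1 - exp (- phi)) = exp phi - 1]; for a pair outside [w] the
   two exponentials cancel, so [F w] sees only pairs of [w], whose endpoints are not isolated. *)
have FE w s : F w s = \prod_(e in w) (expR (phi e s) - 1).
  rewrite /F /wt expR_sum /nu /product_bernoulli -big_split [RHS]big_mkcond /=.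
  apply: eq_bigr => e _; case: ifP => _; last by rewrite -expRD subrr expR0.
  by rewrite mulrBr mulr1 -expRD subrr expR0.
have F_loc w (s t : {ffun I -> bool}) :
    (forall i, i \notin isolated w -> s i = t i) -> F w s = F w t.
  move=> st; rewrite !FE; apply: eq_bigr => e ew; rewrite (phi_loc e s t)//.
    apply: st; rewrite inE -setI_eq0; apply/set0Pn; exists e.
    by rewrite !inE ew eqxx.
  apply: st; rewrite inE -setI_eq0; apply/set0Pn; exists e.
  by rewrite !inE ew eqxx orbT.
have F_sum s : \sum_w F w s = wt s.
  by rewrite -mulr_sumr product_bernoulli_sum1 mulr1.
set n := #|I|%:R; have n_ge1 : 1 <= n by rewrite ler1n.
set c := expR (- L); have c_gt0 : 0 < c by exact: expR_gt0.
pose t := n * c / 2; have t_gt0 : 0 < t by rewrite /t !mulr_gt0//; lra.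
have sn_gt0 : 0 < Num.sqrt n by rewrite sqrtr_gt0; lra.
have L_ge0 : 0 <= L.
  have /card_gt0P[i _] := I_gt0; apply: le_trans (BL i); apply: sumr_ge0 => e _.
  by have /andP[/le_trans] := phiB e [ffun=> true]; apply.
rewrite (eq_bigr (fun s => \sum_w if win s then F w s else 0)); last first.
  by move=> s _; rewrite -/(win s); case: (win s); rewrite ?F_sum// big1.
rewrite exchange_big (bigID (fun w => #|isolated w|%:R < t)) /=.
rewrite /concentration_constant mulrDl [leRHS]mulrDl; apply: lerD.
  (* Few isolated vertices: the window condition is dropped, and for every fixed [s] the tail bound
     applies under [nu s]. *)
  apply: (@le_trans _ _ (\sum_s wt s * \sum_(w | #|isolated w|%:R < t) nu s w)).
    under [leRHS]eq_bigr do rewrite mulr_sumr.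
    rewrite [leRHS]exchange_big /=; apply: ler_sum => w _; apply: ler_sum => s _ /=.
    by case: ifP => // _; exact: F_ge0.
  rewrite [leRHS]mulrC mulr_suml; apply: ler_sum => s _; rewrite ler_wpM2l ?expR_ge0//.
  have := @isolated_lower_tail R I (fun e => phi e s) L.
  move=> /(_ (fun e => phi0 e s) _)/=; rewrite -/n -/c -/t => H.
  have {}H := H _; rewrite -ler_pdivlMr ?exprn_gt0// in H.
  apply: (le_trans (H _)).
    move=> i; apply: le_trans (BL i); apply: ler_sum => e _.
    by have /andP[] := phiB e s.
  rewrite ger0_norm// /t.
  have -> : 2 * L * n / (n * c / 2) ^+ 2 = 8 * L / c ^+ 2 / n.
    by field; rewrite !lt0r_neq0//; lra.
  (* The tail bound is of order [1 / n], weakened to [1 / sqrt n] using [n >= 1]. *)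
  apply: ler_wpM2l; first by rewrite divr_ge0 ?mulr_ge0 ?exprn_ge0 ?expR_ge0.
  rewrite lef_pV2 ?posrE//; last lra.
  rewrite -[leRHS]sqr_sqrtr; last lra.
  by rewrite expr2 ler_peMl ?sqrtr_ge0// -[X in X <= _]sqrtr1 ler_wsqrtr.
(* Many isolated vertices: at least [t] signs are free, so each [F w] gains a factor [1 / sqrt t];
   the remaining sets [w] only enlarge the right-hand side. *)
have -> : Num.sqrt (2 / c) / Num.sqrt n = (Num.sqrt t)^-1.
  rewrite -!sqrtrV ?ltW//; last by lra.
  rewrite -sqrtrM ?divr_ge0 ?ltW//; congr Num.sqrt; rewrite /t.
  by field; rewrite !lt0r_neq0//; lra.
rewrite mulrC ler_pdivlMr ?sqrtr_gt0// mulr_suml.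
under [leRHS]eq_bigr => s _ do rewrite -/(wt s) -F_sum.
rewrite [leRHS]exchange_big [leRHS](bigID (fun w => #|isolated w|%:R < t)) /=.
apply: ler_wpDl; first by apply: sumr_ge0 => w _; apply: sumr_ge0.
apply: ler_sum => w; rewrite -leNgt => tw.
apply: le_trans (littlewood_offord_free_coordinates x (F_ge0 w) (F_loc w) v1).
rewrite ler_wpM2l ?ler_wsqrtr//.
by apply: sumr_ge0 => s _; case: ifP.
Qed.

(** * Reduction of the Hamiltonian to finite sums *)

Local Open Scope classical_set_scope.

Lemma esum_inVn_split (R : realType) (V : countType) (n : nat) (vn : 'I_n -> V)
    (f : V -> \bar R) :
  injective vn -> (forall i, 0 <= f i)%E ->
  (\esum_(i in [set: V]) f i =
   \sum_(k < n) f (vn k) + \esum_(i in [set: V]) (if inVn vn i then 0 else f i))%E.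
Proof.
move=> inj_vn f0.
transitivity (\esum_(i in [set: V])
    (\sum_(k < n) (if i == vn k then f i else 0) +
     (if inVn vn i then 0 else f i)))%E.
  apply: eq_esum => i _; case: ifPn => [/existsP[k /eqP <-]|ni].
    rewrite adde0 (bigD1 k)//= eqxx big1 ?adde0// => l lk.
    by rewrite (inj_eq inj_vn) eq_sym (negPf lk).
  rewrite big1 ?add0e// => k _; case: eqP => // ik.
  by move: ni; rewrite ik => /existsP; case; exists k.
rewrite esumD; last 2 first.
- by move=> i _; apply: sume_ge0 => k _; case: ifP.
- by move=> i _; case: ifP.
congr (_ + _)%E; rewrite esum_sum; last by move=> i k _ _; case: ifP.
apply: eq_bigr => k _; rewrite -[RHS](@esum_set1 R V (vn k) f)// [RHS]esum_mkcond.
by apply: eq_esum => i _; case: eqP => ik; [rewrite mem_set|rewrite memNset].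
Qed.

(** Ordered pairs touching the finite set have both ends inside or exactly one; by symmetry the
    pairs with only the first end inside and those with only the second have equal sums. *)
Lemma esum_touching (R : realType) (V : countType) (n : nat) (vn : 'I_n -> V)
    (G : V -> V -> \bar R) :
  injective vn -> (forall i j, 0 <= G i j)%E -> (forall i j, G i j = G j i) ->
  (\esum_(p in [set: V * V]) (if inVn vn p.1 || inVn vn p.2 then G p.1 p.2 else 0) =
   \sum_(k < n) \sum_(l < n) G (vn k) (vn l) +
   (\sum_(k < n) \esum_(j in [set: V]) (if inVn vn j then 0 else G (vn k) j) +
    \sum_(k < n) \esum_(j in [set: V]) (if inVn vn j then 0 else G (vn k) j)))%E.
Proof.
move=> inj_vn G0 Gsym; pose H i j := if inVn vn i || inVn vn j then G i j else 0%E.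
have H0 i j : (0 <= H i j)%E by rewrite /H; case: ifP.
have inV k : inVn vn (vn k) by apply/existsP; exists k.
have -> : [set: V * V] = [set: V] `*`` (fun=> [set: V]) by apply/seteqP; split.
rewrite -(esum_esum (a := H))// (esum_inVn_split inj_vn); last first.
  by move=> i; exact: esum_ge0.
have -> : (\sum_(k < n) \esum_(j in [set: V]) H (vn k) j =
    \sum_(k < n) \sum_(l < n) G (vn k) (vn l) +
    \sum_(k < n) \esum_(j in [set: V]) (if inVn vn j then 0 else G (vn k) j))%E.
  rewrite -big_split; apply: eq_bigr => k _ /=.
  rewrite (esum_inVn_split inj_vn)//; congr (_ + _)%E.
    by apply: eq_bigr => l _; rewrite /H inV.
  by apply: eq_esum => j _; rewrite /H inV.
rewrite -addeA; congr (_ + (_ + _))%E.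
rewrite -esum_sum; last by move=> j k _ _; case: ifP.
apply: eq_esum => i _; case: ifPn => ni; first by rewrite big1.
rewrite (esum_inVn_split inj_vn)// [X in (_ + X)%E]esum1 ?adde0; last first.
  by move=> j _; rewrite /H (negPf ni) /=; case: (inVn vn j).
by apply: eq_bigr => l _; rewrite /H inV orbT Gsym.
Qed.

Lemma fine_esum_touching (R : realType) (V : countType) (n : nat) (vn : 'I_n -> V)
    (g : V -> V -> R) :
  injective vn -> (forall i j, 0 <= g i j) -> (forall i j, g i j = g j i) ->
  (forall k, \esum_(j in [set: V]) (g (vn k) j)%:E < +oo)%E ->
  fine (\esum_(p in [set: V * V])
          (if inVn vn p.1 || inVn vn p.2 then g p.1 p.2 else 0)%:E) =
  \sum_(k < n) \sum_(l < n) g (vn k) (vn l) +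
  2 * \sum_(k < n) fine (\esum_(j in [set: V])
          (if inVn vn j then 0 else g (vn k) j)%:E).
Proof.
move=> inj_vn g0 gsym gfin.
pose a k := \esum_(j in [set: V]) (if inVn vn j then 0 else (g (vn k) j)%:E)%E.
have aE k : \esum_(j in [set: V]) (if inVn vn j then 0 else g (vn k) j)%:E = a k.
  by apply: eq_esum => j _; case: ifP.
have a_fin k : a k \is a fin_num.
  rewrite ge0_fin_numE; last by apply: esum_ge0 => j _; case: ifP; rewrite ?lee_fin.
  apply: le_lt_trans (gfin k); apply: le_esum => j _.
  by case: ifP => _; rewrite lee_fin.
rewrite [X in _ + 2 * X](eq_bigr (fun k => fine (a k))); last first.
  by move=> k _; rewrite aE.
rewrite (eq_esum (b := fun p => (if inVn vn p.1 || inVn vn p.2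
    then (fun i j => (g i j)%:E) p.1 p.2 else 0)%E)); last first.
  by move=> p _; case: ifP.
rewrite (@esum_touching _ _ _ _ (fun i j => (g i j)%:E) inj_vn)//; last by move=> i j; rewrite gsym.
rewrite -/(a _).
have -> : (\sum_(k < n) a k = (\sum_(k < n) fine (a k))%:E)%E.
  by rewrite -sumEFin; apply: eq_bigr => k _; rewrite fineK.
have -> : (\sum_(k < n) \sum_(l < n) (g (vn k) (vn l))%:E =
    (\sum_(k < n) \sum_(l < n) g (vn k) (vn l))%:E)%E.
  by rewrite -sumEFin; apply: eq_bigr => k _; rewrite sumEFin.
by rewrite -!EFinD /=; ring.
Qed.

(** The nonnegative case is applied to the positive and negative parts; finite row sums make both
    totals finite, so that [fine] loses nothing. *)
Lemma psum_touching (R : realType) (V : countType) (n : nat) (vn : 'I_n -> V)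
    (g : V -> V -> R) :
  injective vn -> (forall i j, g i j = g j i) ->
  (forall k, \esum_(j in [set: V]) `|g (vn k) j|%:E < +oo)%E ->
  psum (fun p => if inVn vn p.1 || inVn vn p.2 then g p.1 p.2 else 0) =
  \sum_(k < n) \sum_(l < n) g (vn k) (vn l) +
  2 * \sum_(k < n) psum (fun j => if inVn vn j then 0 else g (vn k) j).
Proof.
move=> inj_vn gsym gfin; rewrite /psum.
pose gp i j := Num.max (g i j) 0; pose gn i j := Num.max (- g i j) 0.
have gp_fin k : (\esum_(j in [set: V]) (gp (vn k) j)%:E < +oo)%E.
  apply: le_lt_trans (gfin k); apply: le_esum => j _.
  by rewrite lee_fin ge_max ler_norm normr_ge0.
have gn_fin k : (\esum_(j in [set: V]) (gn (vn k) j)%:E < +oo)%E.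
  apply: le_lt_trans (gfin k); apply: le_esum => j _.
  by rewrite lee_fin ge_max ler_normr lexx orbT normr_ge0.
rewrite (eq_esum (b := fun p => (if inVn vn p.1 || inVn vn p.2
    then gp p.1 p.2 else 0)%:E)); last by move=> p _; case: ifP => // _; rewrite maxxx.
rewrite [X in _ - fine X](eq_esum (b := fun p => (if inVn vn p.1 || inVn vn p.2
    then gn p.1 p.2 else 0)%:E)); last first.
  by move=> p _; case: ifP => // _; rewrite oppr0 maxxx.
rewrite (fine_esum_touching inj_vn _ _ gp_fin); last 2 first.
- by move=> i j; rewrite le_max lexx orbT.
- by move=> i j; rewrite /gp gsym.
rewrite (fine_esum_touching inj_vn _ _ gn_fin); last 2 first.
- by move=> i j; rewrite le_max lexx orbT.
- by move=> i j; rewrite /gn gsym.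
rewrite opprD addrACA -mulrBr -!sumrB; congr (_ + _ * _).
  apply: eq_bigr => k _; rewrite -sumrB; apply: eq_bigr => l _.
  rewrite /gp /gn; have [?|?] := leP (g (vn k) (vn l)) 0.
    by rewrite max_l ?oppr_ge0// sub0r opprK.
  by rewrite max_r ?subr0// oppr_le0 ltW.
apply: eq_bigr => k _; congr (fine _ - fine _); apply: eq_esum => j _.
  by case: ifP => // _; rewrite maxxx.
by case: ifP => // _; rewrite oppr0 maxxx.
Qed.

(** The positive and negative parts both have sums in [[0, M]], so their difference is at most [M]
    in absolute value. *)
Lemma psum_norm_le (R : realType) (T : choiceType) (f : T -> R) (M : R) :
  (\esum_(j in [set: T]) `|f j|%:E <= M%:E)%E -> `|psum f| <= M.
Proof.
move=> fM.
have part (u : T -> R) : (forall j, 0 <= u j <= `|f j|) ->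
    0 <= fine (\esum_(j in [set: T]) (u j)%:E) <= M.
  move=> uf; have u0 : (0 <= \esum_(j in [set: T]) (u j)%:E)%E.
    by apply: esum_ge0 => j _; rewrite lee_fin; have /andP[] := uf j.
  have uM : (\esum_(j in [set: T]) (u j)%:E <= M%:E)%E.
    by apply: le_trans fM; apply: le_esum => j _; rewrite lee_fin; have /andP[] := uf j.
  by rewrite fine_ge0// -lee_fin fineK// ge0_fin_numE// (le_lt_trans uM)// ltry.
rewrite /psum.
have /part/andP[] : forall j, 0 <= Num.max (f j) 0 <= `|f j|.
  by move=> j; rewrite le_max lexx orbT ge_max ler_norm normr_ge0.
have /part/andP[] : forall j, 0 <= Num.max (- f j) 0 <= `|f j|.
  by move=> j; rewrite le_max lexx orbT ge_max ler_normr lexx orbT normr_ge0.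
by move=> *; rewrite ler_norml; lra.
Qed.

Lemma extend_vn (V : countType) (n : nat) (vn : 'I_n -> V) kappa s k :
  injective vn -> extend vn kappa s (vn k) = s k.
Proof.
move=> inj_vn; rewrite /extend; case: pickP => [l /eqP/inj_vn -> //|/(_ k)].
by rewrite eqxx.
Qed.

Lemma extend_notin (V : countType) (n : nat) (vn : 'I_n -> V) kappa s j :
  ~~ inVn vn j -> extend vn kappa s j = kappa j.
Proof.
move=> nj; rewrite /extend; case: pickP => // k kj.
by move: nj => /existsP; case; exists k.
Qed.

Definition boundary_field (R : realType) (V : countType) (n : nat) (vn : 'I_n -> V)
    (J : V -> V -> R) (kappa : V -> bool) (k : 'I_n) (b : bool) : R :=
  psum (fun j => if inVn vn j then 0
                 else J (vn k) j * (if b == kappa j then 1 else 0)).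

(** The factor [1/2] of the ordered-pair convention cancels the double count of boundary edges and
    remains only on the inner pairs. *)
Lemma hamiltonian_finite_range (R : realType) (V : countType) (n : nat)
    (vn : 'I_n -> V) (J : V -> V -> R) (kappa : V -> bool) (h : V -> R)
    (s : {ffun 'I_n -> bool}) :
  injective vn -> (forall i j, J i j = J j i) ->
  (forall k, \esum_(j in [set: V]) `|J (vn k) j|%:E < +oo)%E ->
  - hamiltonian vn J kappa h s =
  \sum_(k < n) \sum_(l < n) J (vn k) (vn l) * (if s k == s l then 1 else 0) / 2 +
  \sum_(k < n) (boundary_field vn J kappa k (s k) + h (vn k) * spin R (s k)).
Proof.
move=> inj_vn Jsym Jfin; rewrite /hamiltonian.
pose g i j := J i j * (if extend vn kappa s i == extend vn kappa s j then 1 else 0).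
rewrite (@psum_touching _ _ _ _ g inj_vn); last 2 first.
- by move=> i j; rewrite /g Jsym eq_sym.
- move=> k; apply: le_lt_trans (Jfin k); apply: le_esum => j _.
  rewrite lee_fin /g normrM; case: ifP => _; rewrite ?normr1 ?mulr1//.
  by rewrite normr0 mulr0.
rewrite [X in _ = _ + X]big_split /= opprB opprK [LHS]addrC [RHS]addrA; congr (_ + _).
rewrite mulrDl mulrC; congr (_ + _).
  rewrite mulr_sumr; apply: eq_bigr => k _; rewrite mulr_sumr.
  by apply: eq_bigr => l _; rewrite /g !extend_vn// mulrC.
rewrite mulrAC divff ?pnatr_eq0// mul1r; apply: eq_bigr => k _.
congr psum; apply/funext => j; case: ifPn => // nj.
by rewrite /g extend_vn// extend_notin.
Qed.

(** * Upper bound for the Gibbs measure *)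

Lemma prob_window_le (R : realType) (V : countType) (n : nat)
    (vn : 'I_n -> V) (J : V -> V -> R) (kappa : V -> bool) (h : V -> R)
    (K x : R) (v : 'I_n -> R) :
  (0 < n)%N -> injective vn -> (forall i j, J i j = J j i) ->
  (forall k, \esum_(j in [set: V]) `|J (vn k) j|%:E <= K%:E)%E ->
  (forall k, `|h (vn k)| <= K) ->
  (forall k, 1 <= `|v k|) ->
  prob_window vn J kappa h x v <=
    concentration_constant (10 * K) / Num.sqrt n%:R.
Proof.
move=> n_gt0 inj_vn Jsym JK hK v1.
have K_ge0 : 0 <= K by apply: le_trans (hK (Ordinal n_gt0)).
(* The shifts [|J| / 2] and [2 K] make [phi] nonnegative: the boundary field and the external field
   are each at most [K] in absolute value. The diagonal pairs carry these one-site terms. *)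
pose phi (e : 'I_n * 'I_n) (s : {ffun 'I_n -> bool}) : R :=
  J (vn e.1) (vn e.2) * (if s e.1 == s e.2 then 1 else 0) / 2 +
  `|J (vn e.1) (vn e.2)| / 2 +
  (if e.1 == e.2 then boundary_field vn J kappa e.1 (s e.1) +
    h (vn e.1) * spin R (s e.1) + 2 * K else 0).
pose B (e : 'I_n * 'I_n) : R :=
  `|J (vn e.1) (vn e.2)| + (if e.1 == e.2 then 4 * K else 0).
have fieldK k b : `|boundary_field vn J kappa k b| <= K.
  apply: psum_norm_le; apply: le_trans (JK k); apply: le_esum => j _.
  rewrite lee_fin; case: ifP => _; rewrite ?normr0// normrM.
  by case: ifP => _; rewrite ?normr1 ?mulr1// normr0 mulr0.
have phiB e s : 0 <= phi e s <= B e.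
  rewrite /phi /B; set a := J _ _.
  have : `|a * (if s e.1 == s e.2 then 1 else 0)| <= `|a|.
    by case: ifP => _; rewrite ?mulr1// mulr0 normr0.
  rewrite ler_norml; set y := a * _ => /andP[y1 y2].
  case: ifP => _; last by apply/andP; split; lra.
  have := fieldK e.1 (s e.1); rewrite ler_norml => /andP[? ?].
  have : `|h (vn e.1) * spin R (s e.1)| <= K.
    by rewrite normrM /spin; case: (s e.1); rewrite ?normrN normr1 mulr1.
  by rewrite ler_norml => /andP[? ?]; apply/andP; split; lra.
have rowK k : \sum_(l < n) `|J (vn k) (vn l)| <= K.
  rewrite -lee_fin; apply: le_trans (JK k).
  rewrite (esum_inVn_split inj_vn)// sumEFin leeDl//.
  by apply: esum_ge0 => j _; case: ifP.
(* A star is covered by a row and a column, each of total at most [K + 4 K]; this is the source of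
   [10 K]. *)
have starB i : \sum_(e in star i) B e <= 10 * K.
  have half (F : 'I_n -> R) : (forall l, F l = `|J (vn i) (vn l)| +
      (if i == l then 4 * K else 0)) -> \sum_l F l <= 5 * K.
    move=> FE; under eq_bigr do rewrite FE.
    rewrite big_split /= -big_mkcond [X in _ + X](big_pred1 i); last first.
      by move=> l; rewrite /= eq_sym.
    by have := rowK i; lra.
  apply: (@le_trans _ _ (\sum_l B (i, l) + \sum_l B (l, i))); last first.
    have -> : 10 * K = 5 * K + 5 * K by ring.
    by apply: lerD; apply: half => l; rewrite /B/= // Jsym eq_sym.
  have B0 e : 0 <= B e.
    by rewrite /B; case: ifP => _; rewrite ?addr0// addr_ge0// mulr_ge0.
  have pr1 : \sum_l B (i, l) = \sum_e (if e.1 == i then B e else 0).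
    rewrite -(pair_big predT predT (fun k l => if k == i then B (k, l) else 0)) /=.
    rewrite [RHS](bigD1 i)//= eqxx [X in _ = _ + X]big1 ?addr0// => k ki.
    by rewrite (negPf ki) big1.
  have pr2 : \sum_l B (l, i) = \sum_e (if e.2 == i then B e else 0).
    rewrite -(pair_big predT predT (fun k l => if l == i then B (k, l) else 0)) /=.
    by apply: eq_bigr => k _; rewrite -big_mkcond big_pred1_eq.
  rewrite pr1 pr2 -big_split /= big_mkcond; apply: ler_sum => e _.
  rewrite inE; have := B0 e.
  by case: (e.1 == i); case: (e.2 == i) => /=; lra.
(* The total of the shifts is independent of the spins and cancels in the Gibbs ratio. *)
pose c := \sum_(e : 'I_n * 'I_n)
  (`|J (vn e.1) (vn e.2)| / 2 + (if e.1 == e.2 then 2 * K else 0)).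
have HE s : - hamiltonian vn J kappa h s = \sum_e phi e s - c.
  rewrite hamiltonian_finite_range//; last by move=> k; exact: le_lt_trans (JK k) (ltry _).
  rewrite /c -sumrB pair_big /=.
  have -> : \sum_(k < n) (boundary_field vn J kappa k (s k) + h (vn k) * spin R (s k)) =
     \sum_(e : 'I_n * 'I_n) (if e.1 == e.2 then
       boundary_field vn J kappa e.1 (s e.1) + h (vn e.1) * spin R (s e.1) else 0).
    rewrite -(pair_big predT predT (fun k l => if k == l then
       boundary_field vn J kappa k (s k) + h (vn k) * spin R (s k) else 0)) /=.
    by apply: eq_bigr => k _; rewrite -big_mkcond (big_pred1 k).
  rewrite -big_split; apply: eq_bigr => e _; rewrite /phi /=.
  by case: (s e.1 == s e.2); case: ifP => _; ring.
pose wt s := expR (\sum_e phi e s).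
have gibbsE s : gibbs vn J kappa h s = wt s / \sum_t wt t.
  rewrite /gibbs /partition_fn; under eq_bigr do rewrite HE expRD.
  rewrite -mulr_suml HE expRD -mulf_div divff ?mulr1//.
  by rewrite gt_eqF// expR_gt0.
have Z_gt0 : 0 < \sum_t wt t.
  rewrite (bigD1 [ffun=> true])//= ltr_pwDl ?expR_gt0//.
  by apply: sumr_ge0 => t _; rewrite expR_ge0.
have nI : #|'I_n| = n by rewrite card_ord.
have := @weighted_window_le R _ phi B (10 * K) v x.
rewrite nI => /(_ n_gt0 phiB _ starB v1) le_wt.
rewrite /prob_window -(ler_pM2r Z_gt0); apply: le_trans (le_wt _).
  rewrite mulr_suml; apply: ler_sum => s _; case: ifP => _; last by rewrite mul0r.
  by rewrite gibbsE divfK// gt_eqF.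
by move=> e s t e1 e2; rewrite /phi e1 e2.
Qed.

(** * Lower bound and conclusion *)

Lemma gibbs_sum1 (R : realType) (V : countType) (n : nat) (vn : 'I_n -> V)
    (J : V -> V -> R) (kappa : V -> bool) (h : V -> R) :
  \sum_s gibbs vn J kappa h s = 1.
Proof.
rewrite -mulr_suml divff// gt_eqF// /partition_fn (bigD1 [ffun=> true])//=.
by rewrite ltr_pwDl ?expR_gt0// sumr_ge0// => s _; rewrite expR_ge0.
Qed.

Lemma gibbs_ge0 (R : realType) (V : countType) (n : nat) (vn : 'I_n -> V)
    (J : V -> V -> R) (kappa : V -> bool) (h : V -> R) s :
  0 <= gibbs vn J kappa h s.
Proof. by rewrite divr_ge0 ?expR_ge0// sumr_ge0// => t _; rewrite expR_ge0. Qed.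

(** Flipping [s] on a set [a] gives scalar product [n - 2 #|a|] with [s], so every [a] of size
    [n./2] lands exactly on the centre [x]. *)
Lemma half_flips_in_window (R : realType) (n : nat) (s : {ffun 'I_n -> bool}) (x : R) :
  x = n%:R - 2 * n./2%:R ->
  'C(n, n./2)%:R <= \sum_(t : {ffun 'I_n -> bool})
    (if (x - 1 < \sum_(k < n) spin R (s k) * spin R (t k)) &&
        (\sum_(k < n) spin R (s k) * spin R (t k) < x + 1) then 1 else 0) :> R.
Proof.
move=> xE.
pose flip (a : {set 'I_n}) : {ffun 'I_n -> bool} := [ffun k => s k (+) (k \in a)].
rewrite (reindex flip); last first.
  exists (fun t : {ffun 'I_n -> bool} => [set k | s k (+) t k]%SET) => [a _|t _].
    by apply/setP => k; rewrite inE ffunE addbA addbb.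
  by apply/ffunP => k; rewrite ffunE inE addbA addbb.
have overlap a : \sum_(k < n) spin R (s k) * spin R (flip a k) = n%:R - 2 * #|a|%:R.
  rewrite (eq_bigr (fun k => 1 - 2 * (k \in a)%:R)); last first.
    by move=> k _; rewrite ffunE /spin; case: (s k); case: (k \in a) => /=; ring.
  rewrite big_split /= sumr_const card_ord; congr (_ + _).
  by rewrite sumrN -mulr_sumr -natr_sum -big_mkcond sum1_card.
rewrite -[X in 'C(X, _)]card_ord -card_draws -sum1_card natr_sum big_mkcond /=.
apply: ler_sum => a _; rewrite inE overlap; case: eqP => [->|_].
  by rewrite -xE ifT//; apply/andP; split; lra.
by case: ifP.
Qed.

Lemma Kconst_row_le (R : realType) (V : countType)
    (vn : forall n : nat, 'I_n -> V) (J : V -> V -> R) (h : nat -> V -> R)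
    (K : R) (n : nat) (k : 'I_n) :
  Kconst vn J h = K%:E -> (0 < n)%N ->
  (\esum_(j in [set: V]) `|J (vn n k) j|%:E <= K%:E)%E /\ `|h n (vn n k)| <= K.
Proof.
move=> KE n_gt0.
set a := (\esum_(j in _) _)%E.
have a0 : (0 <= a)%E by apply: esum_ge0 => j _; rewrite lee_fin.
have b0 := normr_ge0 (h n (vn n k)).
have : (a + `|h n (vn n k)|%:E <= K%:E)%E.
  rewrite -KE /Kconst; apply: le_trans; last first.
    by apply: ereal_sup_ubound; exists n.
  rewrite (bigD1 k)//= le_max; apply/orP; left; rewrite leeD2l// lee_fin.
  by rewrite (bigD1 k)//= le_max lexx.
move=> abK; split; first by apply: le_trans abK; rewrite leeDl// lee_fin.
by rewrite -lee_fin; apply: le_trans abK; rewrite leeDr.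
Qed.

Lemma prob_window_le1 (R : realType) (V : countType) (n : nat) (vn : 'I_n -> V)
    (J : V -> V -> R) (kappa : V -> bool) (h : V -> R) (x : R) (v : 'I_n -> R) :
  prob_window vn J kappa h x v <= 1.
Proof.
rewrite -(gibbs_sum1 vn J kappa h); apply: ler_sum => s _.
by case: ifP => // _; exact: gibbs_ge0.
Qed.

Lemma bin_half_le_Qn (R : realType) (V : countType) (n : nat) (vn : 'I_n -> V)
    (J : V -> V -> R) (kappa : V -> bool) (h : V -> R) :
  'C(n, n./2)%:R / 2 ^+ n <= Qn vn J kappa h.
Proof.
pose x : R := n%:R - 2 * n./2%:R.
pose dir (t : {ffun 'I_n -> bool}) (k : 'I_n) := spin R (t k).
rewrite ler_pdivrMr ?exprn_gt0//.
(* The centre [x] is the same for all sign vectors, so after exchanging the sums each [s]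
   contributes its Gibbs weight times at least ['C(n, n./2)]. *)
apply: (@le_trans _ _ (\sum_t prob_window vn J kappa h x (dir t))).
  rewrite /prob_window exchange_big /=.
  rewrite -[leLHS]mulr1 -[X in _ * X <= _](gibbs_sum1 vn J kappa h) mulr_sumr; apply: ler_sum => s _.
  rewrite [leLHS]mulrC.
  apply: (le_trans (ler_wpM2l (gibbs_ge0 _ _ _ _ s) (half_flips_in_window s (erefl x)))).
  rewrite mulr_sumr; apply: ler_sum => t _.
  by rewrite /dir; case: ifP => _; rewrite ?mulr1 ?mulr0.
apply: (@le_trans _ _ (\sum_(t : {ffun 'I_n -> bool}) Qn vn J kappa h)).
  apply: ler_sum => t _; apply: ub_le_sup.
    (* The real [sup] dominates its elements only for a bounded set; probabilities are bounded by
       1. *)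
    by exists 1 => _ [y [v [_ ->]]]; exact: prob_window_le1.
  exists x, (dir t); split => // k.
  by rewrite /dir /spin; case: (t k); rewrite ?normrN normr1.
by rewrite sumr_const card_ffun card_bool card_ord -[leLHS]mulr_natr natrX.
Qed.

Theorem mainTheorem1 (R : realType) (K : R) :
  exists C : R,
  forall (V : countType) (E : rel V) (J : V -> V -> R)
         (vn : forall n : nat, 'I_n -> V)
         (kappa : nat -> V -> bool) (h : nat -> V -> R),
    irreflexive E -> symmetric E ->
    (forall i j, J i j = J j i) ->
    (forall i j, E i j -> J i j != 0) ->
    (forall i j, ~~ E i j -> J i j = 0) ->
    (forall n, injective (vn n)) ->
    Kconst vn J h = K%:E ->
    forall n : nat, (0 < n)%N ->
      ('C(n, n./2)%:R / 2 ^+ n <= Qn (vn n) J (kappa n) (h n)) /\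
      (Qn (vn n) J (kappa n) (h n) <= C / Num.sqrt n%:R).
Proof.
exists (concentration_constant (10 * K)).
move=> V E J vn kappa h _ _ Jsym _ _ inj_vn KE n n_gt0; split.
  exact: bin_half_le_Qn.
apply: sup_le_ub.
  (* Bounding a real [sup] from above requires a nonempty set; [x = 0] and [v = 1] provide an
     element. *)
  by exists (prob_window (vn n) J (kappa n) (h n) 0 (fun=> 1)), 0, (fun=> 1);
    split=> // k; rewrite normr1.
move=> _ [x [v [v1 ->]]]; apply: prob_window_le => // k;
  by have [] := Kconst_row_le k KE n_gt0.
Qed.
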